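(* Let $d\in\{0,1\}$, $r\in\mathbb{Z}_+$, let $V$ be a nonzero $\bar{\mathcal{H}}_{r,d}$-module, and let $\lambda\in\mathbb{C}^*$, $\alpha,\beta\in\mathbb{C}$. On the vector space $\mathcal{M}\big(V,\Omega(\lambda,\alpha,\beta)\big):=V\otimes\mathbb{C}[t]$ define, for $m\in\mathbb{Z}$, $v\in V$, $f(t)\in\mathbb{C}[t]$ and $i\in\{1,2,3\}$, $$L_m\big(v\otimes f(t)\big)=v\otimes\lambda^m(t-m\alpha)f(t-m)+\sum_{i=0}^r\Big(\frac{m^{i+1}}{(i+1)!}\bar L_i\Big)v\otimes\lambda^m f(t-m),$$ $$I_m\big(v\otimes f(t)\big)=\sum_{i=0}^r\Big(\frac{m^{i+d}}{(i+d)!}\bar I_{i+d}\Big)v\otimes\lambda^m\beta f(t-m),\qquad C_i\big(v\otimes f(t)\big)=0.$$ Then these formulas make $\mathcal{M}\big(V,\Omega(\lambda,\alpha,\beta)\big)$ into a non-weight $\mathcal{H}$-module.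
   Context: All vector spaces are over $\mathbb{C}$; $\mathbb{Z}_+$ is the set of nonnegative integers; $0^0=1$. The twisted Heisenberg-Virasoro algebra $\mathcal{H}$ is the complex Lie algebra with basis $\{L_m,I_m,C_i\mid m\in\mathbb{Z},\,i=1,2,3\}$ and brackets $$[L_m,L_n]=(n-m)L_{m+n}+\delta_{m+n,0}\tfrac{m^3-m}{12}C_1,\quad [L_m,I_n]=nI_{m+n}+\delta_{m+n,0}(m^2+m)C_2,\quad [I_m,I_n]=n\delta_{m+n,0}C_3,$$ with $C_1,C_2,C_3$ central. An $\mathcal{H}$-module is a weight module if $\mathrm{span}_{\mathbb{C}}\{L_0,I_0,C_1,C_2,C_3\}$ acts diagonalizably, and non-weight otherwise. For $d\in\{0,1\}$ and $r\in\mathbb{Z}_+$, let $\mathcal{H}_{+,d}=\mathrm{span}_{\mathbb{C}}\{L_i,I_j\mid i\ge0,\ j\ge d\}$ (a Lie subalgebra of $\mathcal{H}$), let $\mathcal{H}_{r,d}$ be the subalgebra (ideal) of $\mathcal{H}_{+,d}$ generated by all $L_i,I_j$ with $i>r$, $j>r+d$, and let $\bar{\mathcal{H}}_{r,d}=\mathcal{H}_{+,d}/\mathcal{H}_{r,d}$; $\bar L_i,\bar I_{i+d}$ denote the images of $L_i,I_{i+d}$ in $\bar{\mathcal{H}}_{r,d}$. *)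

(* Defs.v *)
From HB Require Import structures.
From mathcomp Require Import all_boot all_order all_algebra.
From mathcomp Require Import generic_quotient ring_quotient.
From mathcomp Require Import boolp reals.
From mathcomp Require Import complex finmap monalg.
From mathcomp Require Import ring zify.

Set Implicit Arguments.
Unset Strict Implicit.
Unset Printing Implicit Defensive.

Import GRing.Theory.
Local Open Scope ring_scope.
Local Open Scope quotient_scope.

Lemma submod_rpredB (K : fieldType) (V : lmodType K) (U : submodClosed V) :
  {in U &, forall x y, x - y \in U}.
Proof. by move=> x y xU yU; rewrite -scaleN1r rpredD ?rpredZ. Qed.

Section LinearSpan.
Variables (K : fieldType) (V : lmodType K).
Implicit Types (B : V -> Prop).

Definition lspan B : {pred V} := fun x =>
  `[< exists n (c : 'I_n -> K) (u : 'I_n -> V),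
        (forall i, B (u i)) /\ x = \sum_i c i *: u i >].

Lemma mem_lspan B x : B x -> x \in lspan B.
Proof.
move=> Bx; apply/asboolP; exists 1%N, (fun=> 1), (fun=> x).
by rewrite big_ord1 scale1r.
Qed.

Fact lspan_subsemimod B : subsemimod_closed (lspan B).
Proof.
split; [split|].
- by apply/asboolP; exists 0%N, (fun=> 0), (fun=> 0); split=> [[]|] //;
    rewrite big_ord0.
- move=> x y /asboolP [n [c [u [Bu ->]]]] /asboolP [p [c' [u' [Bu' ->]]]].
  apply/asboolP; exists (n + p)%N.
  exists (fun k => match split k with inl i => c i | inr j => c' j end).
  exists (fun k => match split k with inl i => u i | inr j => u' j end).
  split=> [k|]; first by case: split.
  rewrite big_split_ord /=; congr (_ + _); apply: eq_bigr => i _.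
    by rewrite (unsplitK (inl _ i)).
  by rewrite (unsplitK (inr _ i)).
- move=> a x /asboolP [n [c [u [Bu ->]]]]; apply/asboolP.
  exists n, (fun i => a * c i), u; split=> //.
  by rewrite scaler_sumr; apply: eq_bigr => i _; rewrite scalerA.
Qed.

HB.instance Definition _ B :=
  GRing.isSubmodClosed.Build K V (lspan B) (lspan_subsemimod B).

Lemma lspan_ind B (P : V -> Prop) :
  P 0 -> (forall a x y, P x -> P y -> P (a *: x + y)) ->
  (forall x, B x -> P x) -> forall x, x \in lspan B -> P x.
Proof.
move=> P0 PD PB x /asboolP [n [c [u [Bu ->]]]].
by elim/big_rec: _ => // i y _; apply: PD; apply: PB.
Qed.

Definition lin_indep B := forall n (c : 'I_n -> K) (u : 'I_n -> V),
  injective u -> (forall i, B (u i)) -> \sum_i c i *: u i = 0 ->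
  forall i, c i = 0.

Definition hamel_basis B := lin_indep B /\ forall v, v \in lspan B.

End LinearSpan.

Section QuotientSpace.
Variables (K : fieldType) (V : lmodType K) (U : submodClosed V).

(* MathComp does not derive closure under opposites from a submodClosed
   instance, whereas Quotient.quot asks for a zmodClosed predicate. *)
Definition zmod_of_submod : {pred V} := U.

HB.instance Definition _ := GRing.isZmodClosed.Build V zmod_of_submod
  (GRing.submod_closedB (submodClosedP U)).

Definition lquot := Quotient.quot zmod_of_submod.

HB.instance Definition _ := EqQuotient.on lquot.
HB.instance Definition _ := GRing.Zmodule.on lquot.
HB.instance Definition _ := ZmodQuotient.on lquot.

Definition lpi (x : V) : lquot := \pi_lquot x.

Lemma lpi_eq x y : lpi x = lpi y <-> x - y \in U.
Proof. by rewrite -[_ \in U]/(_ \in zmod_of_submod) Quotient.idealrBE; split=> [/eqP|/eqP]. Qed.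

Lemma lpi_repr (q : lquot) : lpi (repr q) = q.
Proof. exact: reprK. Qed.

Lemma repr_lpi x : repr (lpi x) - x \in U.
Proof. by apply/lpi_eq; rewrite lpi_repr. Qed.

Lemma lpiD x y : lpi (x + y) = lpi x + lpi y.
Proof. exact: raddfD. Qed.

Definition lquot_scale (a : K) (q : lquot) : lquot := lpi (a *: repr q).

Lemma lpiZ_subproof a x : lquot_scale a (lpi x) = lpi (a *: x).
Proof. by apply/lpi_eq; rewrite -scalerBr rpredZ ?repr_lpi. Qed.

Fact lquot_scaleA a b q :
  lquot_scale a (lquot_scale b q) = lquot_scale (a * b) q.
Proof. by rewrite -[q]lpi_repr !lpiZ_subproof scalerA. Qed.

Fact lquot_scale1 : left_id 1 lquot_scale.
Proof. by move=> q; rewrite -[q]lpi_repr !lpiZ_subproof scale1r. Qed.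

Fact lquot_scaleDr : right_distributive lquot_scale +%R.
Proof.
move=> a p q; rewrite -[q]lpi_repr -[p]lpi_repr.
by rewrite -lpiD !lpiZ_subproof -lpiD scalerDr.
Qed.

Fact lquot_scaleDl q : {morph lquot_scale^~ q : a b / a + b}.
Proof.
by move=> a b; rewrite -[q]lpi_repr !lpiZ_subproof -lpiD scalerDl.
Qed.

HB.instance Definition _ := GRing.Zmodule_isLmodule.Build K lquot
  lquot_scaleA lquot_scale1 lquot_scaleDr lquot_scaleDl.

Fact lpi_is_linear : linear lpi.
Proof. by move=> a x y; rewrite lpiD -lpiZ_subproof. Qed.

HB.instance Definition _ :=
  GRing.isLinear.Build K V lquot *:%R lpi lpi_is_linear.

End QuotientSpace.

(* {malg K[I]} is the K-vector space with basis (<< i >>)_(i : I); linext is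
   the linear extension of a map given on this basis. *)
Section FreeSpace.
Variables (K : fieldType) (I : choiceType).

Section LinearExtension.
Variables (M : lmodType K) (f : I -> M).

Definition linext (x : {malg K[I]}) : M :=
  \sum_(i <- msupp x) x@_i *: f i.

Lemma linextw (D : {fset I}) (x : {malg K[I]}) :
  fsubset (msupp x) D -> linext x = \sum_(i <- D) x@_i *: f i.
Proof.
move=> sD; rewrite /linext; apply: big_fset_incl => // i _ iN.
by rewrite mcoeff_outdom ?scale0r.
Qed.

Fact linext_is_linear : linear linext.
Proof.
move=> a x y.
pose D := fsetU (msupp x) (fsetU (msupp y) (msupp (a *: x + y))).
rewrite !(@linextw D) ?fsubsetUl //; last first.
- by rewrite /D fsetUA fsubsetUr.
- by rewrite /D fsetUCA fsubsetUl.
rewrite scaler_sumr -big_split /=; apply: eq_bigr => i _.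
by rewrite mcoeffD mcoeffZ scalerDl scalerA.
Qed.

HB.instance Definition _ :=
  GRing.isLinear.Build K {malg K[I]} M *:%R linext linext_is_linear.

Lemma linextU i : linext << i >> = f i.
Proof.
by rewrite (linextw msuppU_le) big_seq_fset1 mcoeffUU scale1r.
Qed.

End LinearExtension.

Lemma malg_span_ind (P : {malg K[I]} -> Prop) :
  P 0 -> (forall a x y, P x -> P y -> P (a *: x + y)) ->
  (forall i, P << i >>) -> forall x, P x.
Proof.
move=> P0 PD PU x; rewrite [x]monalgE.
elim/big_rec: _ => // i y _ Py.
suff -> : << x@_i *g i >> = x@_i *: << i >> :> {malg K[I]} by apply: PD.
by apply/malgP => k; rewrite mcoeffZ !mcoeffU mulr_natr.
Qed.

End FreeSpace.

Section Tensor.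
Variables (K : fieldType) (V W : lmodType K).

Local Notation free := {malg K[(V * W)%type]}.

Definition ftens (v : V) (w : W) : free := << (v, w) >>.

Inductive tensor_rel : free -> Prop :=
| TensorDl v v' w : tensor_rel (ftens (v + v') w - (ftens v w + ftens v' w))
| TensorDr v w w' : tensor_rel (ftens v (w + w') - (ftens v w + ftens v w'))
| TensorZl a v w : tensor_rel (ftens (a *: v) w - a *: ftens v w)
| TensorZr a v w : tensor_rel (ftens v (a *: w) - a *: ftens v w).

Definition tensor := lquot (lspan tensor_rel).

HB.instance Definition _ := GRing.Lmodule.on tensor.

Definition tens (v : V) (w : W) : tensor := lpi _ (ftens v w).

Lemma tens_linearl w : linear (tens^~ w).
Proof.
move=> a v v'; rewrite /tens -linearP.
apply: (etrans (y := lpi _ (ftens (a *: v) w + ftens v' w))); apply/lpi_eq.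
  exact/mem_lspan/TensorDl.
by rewrite opprD addrACA subrr addr0; exact/mem_lspan/TensorZl.
Qed.

Lemma tens_linearr v : linear (tens v).
Proof.
move=> a w w'; rewrite /tens -linearP.
apply: (etrans (y := lpi _ (ftens v (a *: w) + ftens v w'))); apply/lpi_eq.
  exact/mem_lspan/TensorDr.
by rewrite opprD addrACA subrr addr0; exact/mem_lspan/TensorZr.
Qed.

Lemma tensor_ind (P : tensor -> Prop) :
  P 0 -> (forall a x y, P x -> P y -> P (a *: x + y)) ->
  (forall v w, P (tens v w)) -> forall x, P x.
Proof.
move=> P0 PD Pt x; rewrite -[x]lpi_repr.
elim/malg_span_ind: (repr x) => [|a y z Py Pz|[v w]].
- by rewrite raddf0.
- by rewrite linearP; apply: PD.
- exact: Pt.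
Qed.

Lemma tensor_lift (M : lmodType K) (b : V -> W -> M) :
  (forall w, linear (b^~ w)) -> (forall v, linear (b v)) ->
  exists f : {linear tensor -> M}, forall v w, f (tens v w) = b v w.
Proof.
move=> bl br.
have [g gU] : exists g : {linear free -> M}, forall v w, g (ftens v w) = b v w.
  by exists (linext (fun p : V * W => b p.1 p.2)) => v w; rewrite /= linextU.
have bZl a v w : b (a *: v) w = a *: b v w.
  have b0 : b 0 w = 0.
    by have /(congr1 (+%R^~ (- b 0 w))) := bl w 1 0 0;
      rewrite !scale1r addr0 subrr addrK.
  by have := bl w a v 0; rewrite b0 !addr0.
have bZr a v w : b v (a *: w) = a *: b v w.
  have b0 : b v 0 = 0.
    by have /(congr1 (+%R^~ (- b v 0))) := br v 1 0 0;
      rewrite !scale1r addr0 subrr addrK.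
  by have := br v a w 0; rewrite b0 !addr0.
have gK x : x \in lspan tensor_rel -> g x = 0.
  elim/lspan_ind => {x} [|a x y gx gy|x]; first exact: raddf0.
    by rewrite linearP gx gy scaler0 addr0.
  case=> [v v' w|v w w'|a v w|a v w]; 
    rewrite raddfB ?(raddfD g) /= !gU.
  - by have /= := bl w 1 v v'; rewrite !scale1r => ->; rewrite subrr.
  - by have /= := br v 1 w w'; rewrite !scale1r => ->; rewrite subrr.
  - by rewrite bZl linearZ /= gU subrr.
  - by rewrite bZr linearZ /= gU subrr.
have gE x : g (repr (lpi (lspan tensor_rel) x)) = g x.
  by apply/eqP; rewrite -subr_eq0 -raddfB /= gK ?repr_lpi.
pose f (q : tensor) := g (repr q).
have fl : linear f.
  move=> a p q; rewrite -[p]lpi_repr -[q]lpi_repr /f -linearP !gE.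
  exact: linearP.
exists (HB.pack_for {linear tensor -> M} f
  (GRing.isLinear.Build K tensor M *:%R f fl)) => v w /=.
by rewrite /f gE gU.
Qed.

End Tensor.

HB.mixin Record isLieAlgebra (K : fieldType) L of GRing.Lmodule K L := {
  bracket : L -> L -> L;
  bracket_linearl : forall y, linear (bracket^~ y);
  bracket_linearr : forall x, linear (bracket x);
  bracketxx : forall x, bracket x x = 0;
  jacobi : forall x y z,
    bracket x (bracket y z) + bracket y (bracket z x)
      + bracket z (bracket x y) = 0
}.

#[short(type="lieAlgType")]
HB.structure Definition LieAlgebra (K : fieldType) :=
  {L of isLieAlgebra K L & GRing.Lmodule K L}.

Record lieModule (K : fieldType) (g : lieAlgType K) (M : lmodType K) :=
  LieModule {
    act :> g -> M -> M;
    act_linearl : forall v, linear (act^~ v);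
    act_linearr : forall x, linear (act x);
    act_bracket : forall x y v,
      act (bracket x y) v = act x (act y v) - act y (act x v)
  }.

Section LieTheory.
Variables (K : fieldType) (g : lieAlgType K).
Implicit Types x y z : g.

HB.instance Definition _ x :=
  GRing.isLinear.Build K g g *:%R (bracket x) (bracket_linearr x).

Lemma bracketC x y : bracket x y = - bracket y x.
Proof.
have Dl u v w : bracket (u + v) w = bracket u w + bracket v w.
  by have := bracket_linearl w 1 u v; rewrite /= !scale1r.
have := bracketxx (x + y); rewrite Dl !raddfD /= !bracketxx add0r addr0.
by move/eqP; rewrite addr_eq0 => /eqP.
Qed.

Lemma bracket_leibniz x y z :
  bracket x (bracket y z) = bracket (bracket x y) z + bracket y (bracket x z).
Proof.
apply/eqP; rewrite -subr_eq0 opprD addrC -(jacobi x y z).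
rewrite [bracket z x]bracketC raddfN [bracket z (bracket x y)]bracketC /=.
by rewrite addrC addrAC addrA.
Qed.

End LieTheory.

HB.mixin Record isBracketClosed (K : fieldType) (g : lieAlgType K)
    (S : g -> bool) := {
  rpred_bracket : {in S &, forall x y, bracket x y \in S}
}.

#[short(type="lieSubalg")]
HB.structure Definition LieSubalg (K : fieldType) (g : lieAlgType K) :=
  {S of GRing.AddClosed g S & GRing.isScaleClosed K g S & isBracketClosed K g S}.

HB.mixin Record isBracketAbsorbing (K : fieldType) (g : lieAlgType K)
    (S : g -> bool) := {
  ideal_bracket : forall x, {in S, forall y, bracket x y \in S}
}.

#[short(type="lieIdeal")]
HB.structure Definition LieIdeal (K : fieldType) (g : lieAlgType K) :=
  {S of GRing.AddClosed g S & GRing.isScaleClosed K g S & isBracketAbsorbing K g S}.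

Section SubalgebraType.
Variables (K : fieldType) (g : lieAlgType K) (S : lieSubalg g).

Record subalg := Subalg { subalg_val : g; _ : subalg_val \in (S : {pred g}) }.

HB.instance Definition _ := [isSub for subalg_val].
HB.instance Definition _ := [Choice of subalg by <:].
HB.instance Definition _ := [SubChoice_isSubLmodule of subalg by <:].

Definition subalg_bracket (x y : subalg) : subalg :=
  Sub (bracket (val x) (val y))
      (rpred_bracket (val x) (val y) (valP x) (valP y)).

Fact subalg_bracket_linearl y : linear (subalg_bracket^~ y).
Proof.
move=> a x x'; apply: val_inj; rewrite [RHS]linearP SubK [val (_ + _)]linearP.
exact: bracket_linearl.
Qed.

Fact subalg_bracket_linearr x : linear (subalg_bracket x).
Proof.
move=> a y y'; apply: val_inj; rewrite [RHS]linearP SubK [val (_ + _)]linearP.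
exact: bracket_linearr.
Qed.

Fact subalg_bracketxx x : subalg_bracket x x = 0.
Proof. by apply: val_inj; rewrite SubK bracketxx raddf0. Qed.

Fact subalg_jacobi x y z :
  subalg_bracket x (subalg_bracket y z) + subalg_bracket y (subalg_bracket z x)
    + subalg_bracket z (subalg_bracket x y) = 0.
Proof. by apply: val_inj; rewrite !raddfD raddf0; exact: jacobi. Qed.

HB.instance Definition _ := isLieAlgebra.Build K subalg
  subalg_bracket_linearl subalg_bracket_linearr subalg_bracketxx subalg_jacobi.

End SubalgebraType.

Section QuotientAlgebra.
Variables (K : fieldType) (g : lieAlgType K) (J : lieIdeal g).

Definition lie_quot := lquot J.

HB.instance Definition _ := GRing.Lmodule.on lie_quot.

Definition lie_quot_bracket (p q : lie_quot) : lie_quot :=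
  lpi J (bracket (repr p) (repr q)).

Lemma lie_quot_bracketE x y :
  lie_quot_bracket (lpi J x) (lpi J y) = lpi J (bracket x y).
Proof.
apply/lpi_eq; set x' := repr _; set y' := repr _.
have -> : bracket x' y' - bracket x y
          = bracket x' (y' - y) - bracket y (x' - x).
  rewrite [bracket y (_ - _)]raddfB [bracket x' (_ - _)]raddfB /= opprB.
  by rewrite (bracketC y x) (bracketC y x') opprK (addrC (- _)) addrA subrK.
by rewrite submod_rpredB ?ideal_bracket ?repr_lpi.
Qed.

Fact lie_quot_linearl q : linear (lie_quot_bracket^~ q).
Proof.
move=> a p p'; rewrite -[p]lpi_repr -[p']lpi_repr -[q]lpi_repr -linearP.
by rewrite !lie_quot_bracketE -linearP; congr lpi; apply: bracket_linearl.
Qed.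

Fact lie_quot_linearr p : linear (lie_quot_bracket p).
Proof.
move=> a q q'; rewrite -[p]lpi_repr -[q]lpi_repr -[q']lpi_repr -linearP.
by rewrite !lie_quot_bracketE -linearP; congr lpi; apply: bracket_linearr.
Qed.

Fact lie_quot_bracketxx p : lie_quot_bracket p p = 0.
Proof. by rewrite -[p]lpi_repr lie_quot_bracketE bracketxx raddf0. Qed.

Fact lie_quot_jacobi x y z :
  lie_quot_bracket x (lie_quot_bracket y z)
    + lie_quot_bracket y (lie_quot_bracket z x)
    + lie_quot_bracket z (lie_quot_bracket x y) = 0.
Proof.
rewrite -[x]lpi_repr -[y]lpi_repr -[z]lpi_repr !lie_quot_bracketE -!raddfD.
by rewrite jacobi raddf0.
Qed.

HB.instance Definition _ := isLieAlgebra.Build K lie_quot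
  lie_quot_linearl lie_quot_linearr lie_quot_bracketxx lie_quot_jacobi.

End QuotientAlgebra.

Section GeneratedSubalgebra.
Variables (K : fieldType) (g : lieAlgType K) (G : g -> Prop).

Definition lie_gen : {pred g} := fun x =>
  `[< forall S : lieSubalg g,
        (forall y, G y -> y \in (S : {pred g})) -> x \in (S : {pred g}) >].

Lemma mem_lie_gen x : G x -> x \in lie_gen.
Proof. by move=> Gx; apply/asboolP => S; apply. Qed.

Fact lie_gen_subsemimod : subsemimod_closed lie_gen.
Proof.
split; [split|].
- by apply/asboolP => S _; exact: rpred0.
- move=> x y /asboolP xS /asboolP yS; apply/asboolP => S GS.
  by rewrite rpredD ?xS ?yS.
- move=> a x /asboolP xS; apply/asboolP => S GS.
  by rewrite rpredZ ?xS.
Qed.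

HB.instance Definition _ :=
  GRing.isSubmodClosed.Build K g lie_gen lie_gen_subsemimod.

Fact lie_gen_bracket : {in lie_gen &, forall x y, bracket x y \in lie_gen}.
Proof.
move=> x y /asboolP xS /asboolP yS; apply/asboolP => S GS.
by rewrite rpred_bracket ?xS ?yS.
Qed.

HB.instance Definition _ := isBracketClosed.Build K g lie_gen lie_gen_bracket.

Lemma lie_gen_ind (P : g -> Prop) :
  P 0 -> (forall a x y, P x -> P y -> P (a *: x + y)) ->
  (forall x y, P x -> P y -> P (bracket x y)) ->
  (forall x, G x -> P x) -> forall x, x \in lie_gen -> P x.
Proof.
move=> P0 PD PB PG x /asboolP xP.
pose S : {pred g} := fun x => `[< P x >].
have S_submod : subsemimod_closed S.
  apply: GRing.submod_closed_semi; split; first exact/asboolP.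
  by move=> a u v /asboolP Pu /asboolP Pv; apply/asboolP/PD.
have S_bracket : {in S &, forall x y, bracket x y \in S}.
  by move=> u v /asboolP Pu /asboolP Pv; apply/asboolP/PB.
pose SL := HB.pack_for (lieSubalg g) S
  (GRing.isSubmodClosed.Build K g S S_submod)
  (isBracketClosed.Build K g S S_bracket).
by apply/asboolP/(xP SL) => y Gy; apply/asboolP/PG.
Qed.

Lemma lie_gen_ideal :
  (forall x y, G y -> bracket x y \in lie_gen) ->
  forall x, {in lie_gen, forall y, bracket x y \in lie_gen}.
Proof.
move=> GB x y yG; suff [_ yJ] : y \in lie_gen /\ forall x, bracket x y \in lie_gen.
  exact: yJ.
elim/lie_gen_ind: yG => {x y} [|a y z [yG yB] [zG zB]|y z [yG yB] [zG zB]|y Gy].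
- by split=> [|x]; rewrite ?raddf0 rpred0.
- split=> [|x]; first by rewrite rpredD ?rpredZ.
  by rewrite bracket_linearr rpredD ?rpredZ.
- split=> [|x]; first exact: rpred_bracket.
  rewrite bracket_leibniz.
  exact: (rpredD (rpred_bracket _ _ (yB x) zG) (rpred_bracket _ _ yG (zB x))).
- by split=> [|x]; [exact: mem_lie_gen | exact: GB].
Qed.

End GeneratedSubalgebra.

Definition acts_diagonalizably (K : fieldType) (g : lieAlgType K)
    (M : lmodType K) (rho : lieModule g M) (h : {pred g}) :=
  exists B : M -> Prop, hamel_basis B /\
    forall b, B b -> forall x, x \in h -> exists c : K, rho x b = c *: b.

Inductive hvIndex : predArgType :=
  idxL of int | idxI of int | idxC1 | idxC2 | idxC3.

Definition hvIndex_encode (a : hvIndex) : int + int + 'I_3 :=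
  match a with
  | idxL m => inl (inl m)
  | idxI m => inl (inr m)
  | idxC1 => inr 0
  | idxC2 => inr 1
  | idxC3 => inr 2
  end.

Definition hvIndex_decode (x : int + int + 'I_3) : hvIndex :=
  match x with
  | inl (inl m) => idxL m
  | inl (inr m) => idxI m
  | inr i => if i == 0 then idxC1 else if i == 1 then idxC2 else idxC3
  end.

Fact hvIndex_encodeK : cancel hvIndex_encode hvIndex_decode.
Proof. by case. Qed.

HB.instance Definition _ := Choice.copy hvIndex (can_type hvIndex_encodeK).

(* The brackets of basis vectors, for any vector space and any family e of
   vectors standing for the basis; the bracket [I_n, L_m] is fixed by
   antisymmetry. *)
Section StructureConstants.
Variables (K : fieldType) (V : lmodType K) (e : hvIndex -> V).

Local Notation L m := (e (idxL m)).
Local Notation I m := (e (idxI m)).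
Local Notation C1 := (e idxC1).
Local Notation C2 := (e idxC2).
Local Notation C3 := (e idxC3).

Definition hv_LI_bracket (m n : int) : V :=
  n%:~R *: I (m + n) + ((m + n == 0)%:R * (m ^+ 2 + m)%:~R) *: C2.

Definition hv_basis_bracket (a b : hvIndex) : V :=
  match a, b with
  | idxL m, idxL n =>
      (n - m)%:~R *: L (m + n)
      + ((m + n == 0)%:R * ((m ^+ 3 - m)%:~R / 12%:R)) *: C1
  | idxL m, idxI n => hv_LI_bracket m n
  | idxI n, idxL m => - hv_LI_bracket m n
  | idxI m, idxI n => ((m + n == 0)%:R * n%:~R) *: C3
  | _, _ => 0
  end.

Lemma hv_basis_bracketC a b : hv_basis_bracket a b = - hv_basis_bracket b a.
Proof.
case: a b => [m|m|||] [n|n|||] //=; rewrite ?opprK ?oppr0 //.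
- rewrite [n + m]addrC opprD -!scaleNr; congr (_ *: _ + _ *: _).
    by rewrite -rmorphN opprB.
  have [/eqP|_] := eqVneq (m + n) 0; last by rewrite !mul0r oppr0.
  rewrite addr_eq0 => /eqP ->; rewrite !mul1r -mulNr -rmorphN.
  by congr (_%:~R / _); ring.
- rewrite [n + m]addrC -scaleNr; congr (_ *: _).
  have [/eqP|_] := eqVneq (m + n) 0; last by rewrite !mul0r oppr0.
  by rewrite addr_eq0 => /eqP ->; rewrite !mul1r rmorphN opprK.
Qed.

Lemma hv_basis_bracketxx a : hv_basis_bracket a a = 0.
Proof.
case: a => [m|m|||] //=; rewrite ?subrr ?scale0r ?add0r.
  have [mm|_] := eqVneq (m + m) 0; last by rewrite mul0r scale0r.
  have -> : m = 0 by lia.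
  by rewrite expr0n subrr !mul0r mulr0 scale0r.
have [mm|_] := eqVneq (m + m) 0; last by rewrite mul0r scale0r.
have -> : m = 0 by lia.
by rewrite mulr0 scale0r.
Qed.

Variable br : V -> V -> V.
Hypotheses (brl : forall y, linear (br^~ y)) (brr : forall x, linear (br x)).
Hypothesis brE : forall a b, br (e a) (e b) = hv_basis_bracket a b.

Let brDr x y z : br x (y + z) = br x y + br x z.
Proof. by have := brr x 1 y z; rewrite /= !scale1r. Qed.

Let br0r z : br z 0 = 0.
Proof. by apply: (addrI (br z 0)); rewrite -brDr !addr0. Qed.

Let brZr a x z : br z (a *: x) = a *: br z x.
Proof. by have := brr z a x 0; rewrite /= br0r !addr0. Qed.

Let brNr x z : br z (- x) = - br z x.
Proof. by rewrite -scaleN1r brZr scaleN1r. Qed.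

Let jac x y z := br x (br y z) + br y (br z x) + br z (br x y).

Let jac_rot x y z : jac x y z = jac y z x.
Proof. by rewrite /jac [RHS]addrC addrA. Qed.

Let comb3 (u w : V) p1 p2 p3 q1 q2 q3 :
  p1 + p2 + p3 = 0 -> q1 + q2 + q3 = 0 ->
  p1 *: u + q1 *: w + (p2 *: u + q2 *: w) + (p3 *: u + q3 *: w) = 0.
Proof.
move=> p q; rewrite [X in X + _]addrACA [LHS]addrACA -!scalerDl.
by rewrite p q !scale0r addr0.
Qed.

Let jacLLL m n k : jac (L m) (L n) (L k) = 0.
Proof.
rewrite /jac !brE /= !brDr !brZr !brE /= !scaler0 !addr0 !scalerDr !scalerA.
have -> : n + (k + m) = m + (n + k) by ring.
have -> : k + (m + n) = m + (n + k) by ring.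
apply: comb3; first by rewrite !(rmorphB, rmorphD) /=; ring.
have [/eqP|_] := eqVneq (m + (n + k)) 0; last by rewrite !mul0r !mulr0 !addr0.
rewrite addr_eq0 => /eqP ->; rewrite !mul1r.
rewrite !mulrA -!mulrDl -!rmorphM -!rmorphD /=.
by rewrite [X in X%:~R](_ : _ = 0) ?mul0r; last by ring.
Qed.

Let jacLLI m n k : jac (L m) (L n) (I k) = 0.
Proof.
rewrite /jac !brE /= /hv_LI_bracket !brNr !brDr !brZr !brE /= /hv_LI_bracket.
rewrite !scaler0 !addr0 !scalerDr !scalerN !opprD !scalerA -!scaleNr.
rewrite !scalerDr !scalerA.
have -> : n + (m + k) = m + (n + k) by ring.
have -> : m + n + k = m + (n + k) by ring.
apply: comb3; first by rewrite !(rmorphB, rmorphD) /=; ring.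
have [/eqP|_] := eqVneq (m + (n + k)) 0.
  rewrite addr_eq0 => /eqP ->; rewrite !mul1r.
  by rewrite !(rmorphB, rmorphD, rmorphN, rmorphXn) /=; ring.
by rewrite !mul0r !mulr0 !oppr0 !addr0.
Qed.

Let jacLII m n k : jac (L m) (I n) (I k) = 0.
Proof.
rewrite /jac !brE /= /hv_LI_bracket !brNr !brDr !brZr !brE /= !scaler0 !addr0.
have -> : k + (m + n) = m + (n + k) by ring.
have -> : n + (m + k) = m + (n + k) by ring.
rewrite add0r !scalerA -scaleNr -scalerDl.
have [/eqP|_] := eqVneq (m + (n + k)) 0.
  rewrite addr_eq0 => /eqP ->; rewrite !mul1r.
  by rewrite (_ : _ + _ = 0) ?scale0r // !(rmorphD, rmorphN) /=; ring.
by rewrite !mul0r !mulr0 oppr0 addr0 scale0r.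
Qed.

Let jacIII m n k : jac (I m) (I n) (I k) = 0.
Proof. by rewrite /jac !brE /= !brZr !brE /= !scaler0 !addr0. Qed.

Let jacC (c : hvIndex) y z :
  match c with idxL _ | idxI _ => False | _ => True end ->
  jac (e c) (e y) (e z) = 0.
Proof.
have eqc b : match c with idxL _ | idxI _ => False | _ => True end ->
    br (e c) (e b) = 0 /\ br (e b) (e c) = 0.
  by rewrite !brE; case: c b => [?|?|||] [?|?|||].
move=> hc; rewrite /jac brE.
have [-> _] := eqc y hc; have [_ ->] := eqc z hc; rewrite !br0r !addr0.
have c0 t : br (e c) (e t) = 0 by have [] := eqc t hc.
case: y z => [?|?|||] [?|?|||] //=; rewrite /hv_LI_bracket;
  by rewrite ?(brNr, brDr, brZr, br0r, c0, scaler0, addr0, oppr0).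
Qed.

Lemma hv_basis_jacobi a b c :
  br (e a) (br (e b) (e c)) + br (e b) (br (e c) (e a))
    + br (e c) (br (e a) (e b)) = 0.
Proof.
rewrite -/(jac _ _ _).
case: a => [m|m|||]; try exact: jacC.
all: case: b => [n|n|||]; try by rewrite jac_rot; exact: jacC.
all: case: c => [k|k|||]; try by rewrite jac_rot jac_rot; exact: jacC.
- exact: jacLLL.
- exact: jacLLI.
- by rewrite jac_rot jac_rot; exact: jacLLI.
- exact: jacLII.
- by rewrite jac_rot; exact: jacLLI.
- by rewrite jac_rot; exact: jacLII.
- by rewrite jac_rot jac_rot; exact: jacLII.
- exact: jacIII.
Qed.

End StructureConstants.

Section HeisenbergVirasoro.
Variable K : fieldType.

Definition heisVir : Type := {malg K[hvIndex]}.

HB.instance Definition _ := GRing.Lmodule.on heisVir.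

Definition hv_basis (a : hvIndex) : heisVir := << a >>.

Definition hvL (m : int) : heisVir := hv_basis (idxL m).
Definition hvI (m : int) : heisVir := hv_basis (idxI m).
Definition hvC1 : heisVir := hv_basis idxC1.
Definition hvC2 : heisVir := hv_basis idxC2.
Definition hvC3 : heisVir := hv_basis idxC3.

Definition hv_bracket (x y : heisVir) : heisVir :=
  linext (fun a => linext (hv_basis_bracket hv_basis a) y) x.

Fact hv_bracket_linearl y : linear (hv_bracket^~ y).
Proof. exact: linext_is_linear. Qed.

Fact hv_bracket_linearr x : linear (hv_bracket x).
Proof.
move=> a y z; rewrite /hv_bracket /linext scaler_sumr -big_split /=.
apply: eq_bigr => i _; rewrite -/(linext _ _) linext_is_linear.
by rewrite scalerDr scalerA mulrC -scalerA.
Qed.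

Lemma hv_bracketE a b :
  hv_bracket (hv_basis a) (hv_basis b) = hv_basis_bracket hv_basis a b.
Proof. by rewrite /hv_bracket !linextU. Qed.

End HeisenbergVirasoro.

Section LieOnBasis.
Variables (K : fieldType) (V : lmodType K) (I : Type) (e : I -> V).
Variable br : V -> V -> V.
Hypotheses (brl : forall y, linear (br^~ y)) (brr : forall x, linear (br x)).
Hypothesis e_ind : forall P : V -> Prop, P 0 ->
  (forall a x y, P x -> P y -> P (a *: x + y)) -> (forall i, P (e i)) ->
  forall x, P x.
Hypothesis brC : forall i j, br (e i) (e j) = - br (e j) (e i).
Hypothesis brxx : forall i, br (e i) (e i) = 0.
Hypothesis brJ : forall i j k,
  br (e i) (br (e j) (e k)) + br (e j) (br (e k) (e i))
    + br (e k) (br (e i) (e j)) = 0.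

Let br0l z : br 0 z = 0.
Proof.
apply: (addrI (br 0 z)); rewrite addr0.
by have := brl z 1 0 0; rewrite /= !scale1r addr0 => <-.
Qed.

Let br0r z : br z 0 = 0.
Proof.
apply: (addrI (br z 0)); rewrite addr0.
by have := brr z 1 0 0; rewrite /= !scale1r addr0 => <-.
Qed.

Let brCx x y : br x y = - br y x.
Proof.
elim/e_ind: x => [|a x z IHx IHz|i]; first by rewrite br0l br0r oppr0.
  by rewrite brl brr IHx IHz opprD scalerN.
elim/e_ind: y => [|a x z IHx IHz|j]; first by rewrite br0l br0r oppr0.
  by rewrite brl brr IHx IHz opprD scalerN.
exact: brC.
Qed.

Lemma alternating_on_basis x : br x x = 0.
Proof.
elim/e_ind: x => [|a x z IHx IHz|//]; first exact: br0l.
rewrite brl !brr IHx IHz (brCx z) scaler0 addr0 add0r.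
by rewrite scalerN subrr.
Qed.

Let jac x y z := br x (br y z) + br y (br z x) + br z (br x y).

Let jac_rot x y z : jac x y z = jac y z x.
Proof. by rewrite /jac [RHS]addrC addrA. Qed.

Let jac0 y z : jac 0 y z = 0.
Proof. by rewrite /jac !(br0l, br0r) !addr0. Qed.

Let jac_linear a x x' y z : jac (a *: x + x') y z = a *: jac x y z + jac x' y z.
Proof.
rewrite /jac !(brl, brr) !scalerDr.
by rewrite [X in X + _]addrACA [LHS]addrACA.
Qed.

Lemma jacobi_on_basis x y z : jac x y z = 0.
Proof.
elim/e_ind: x => [|a x x' IH IH'|i]; first exact: jac0.
  by rewrite jac_linear IH IH' scaler0 addr0.
rewrite jac_rot; elim/e_ind: y => [|a x x' IH IH'|j]; first exact: jac0.
  by rewrite jac_linear IH IH' scaler0 addr0.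
rewrite jac_rot; elim/e_ind: z => [|a x x' IH IH'|k]; first exact: jac0.
  by rewrite jac_linear IH IH' scaler0 addr0.
exact: brJ.
Qed.

End LieOnBasis.

Section HeisenbergVirasoroLie.
Variable K : fieldType.

Fact hv_bracketxx (x : heisVir K) : hv_bracket x x = 0.
Proof.
apply: (@alternating_on_basis _ _ _ (@hv_basis K)).
- exact: hv_bracket_linearl.
- exact: hv_bracket_linearr.
- exact: malg_span_ind.
- by move=> i j; rewrite !hv_bracketE hv_basis_bracketC.
- by move=> i; rewrite hv_bracketE hv_basis_bracketxx.
Qed.

Fact hv_jacobi (x y z : heisVir K) :
  hv_bracket x (hv_bracket y z) + hv_bracket y (hv_bracket z x)
    + hv_bracket z (hv_bracket x y) = 0.
Proof.
apply: (@jacobi_on_basis _ _ _ (@hv_basis K) (@hv_bracket K)).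
- exact: hv_bracket_linearl.
- exact: hv_bracket_linearr.
- exact: malg_span_ind.
- move=> a b c; apply: (@hv_basis_jacobi _ _ (@hv_basis K)).
  + exact: hv_bracket_linearr.
  + exact: hv_bracketE.
Qed.

HB.instance Definition _ := isLieAlgebra.Build K (heisVir K)
  (@hv_bracket_linearl K) (@hv_bracket_linearr K) hv_bracketxx hv_jacobi.

Lemma bracket_hv_basis a b :
  bracket (hv_basis K a) (hv_basis K b) = hv_basis_bracket (hv_basis K) a b.
Proof. exact: hv_bracketE. Qed.

Variable d : nat.

Inductive Hplus_gen : heisVir K -> Prop :=
| Hplus_genL (i : nat) : Hplus_gen (hvL K i%:Z)
| Hplus_genI (j : nat) : (d <= j)%N -> Hplus_gen (hvI K j%:Z).

Definition Hplus_set : {pred heisVir K} := lspan Hplus_gen.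

HB.instance Definition _ := GRing.SubmodClosed.on Hplus_set.

Lemma bracketLL (i j : nat) :
  bracket (hvL K i%:Z) (hvL K j%:Z)
    = (j%:Z - i%:Z)%:~R *: hvL K (i + j)%N%:Z.
Proof.
rewrite bracket_hv_basis /= -PoszD; case: eqVneq => [ij|_].
  have -> : i = 0%N by lia.
  by rewrite expr0n subrr mul0r mulr0 scale0r addr0.
by rewrite mul0r scale0r addr0.
Qed.

Lemma bracketLI (i j : nat) :
  bracket (hvL K i%:Z) (hvI K j%:Z) = j%:~R *: hvI K (i + j)%N%:Z.
Proof.
rewrite bracket_hv_basis /= /hv_LI_bracket -PoszD; case: eqVneq => [ij|_].
  have -> : i = 0%N by lia.
  by rewrite expr0n addr0 mulr0 scale0r addr0.
by rewrite mul0r scale0r addr0.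
Qed.

Lemma bracketIL (i j : nat) :
  bracket (hvI K j%:Z) (hvL K i%:Z) = - (j%:~R *: hvI K (i + j)%N%:Z).
Proof. by rewrite bracketC bracketLI. Qed.

Lemma bracketII (i j : nat) : bracket (hvI K i%:Z) (hvI K j%:Z) = 0.
Proof.
rewrite bracket_hv_basis /= -PoszD; case: eqVneq => [ij|_].
  have -> : j = 0%N by lia.
  by rewrite mulr0 scale0r.
by rewrite mul0r scale0r.
Qed.

Fact Hplus_bracket : {in Hplus_set &, forall x y, bracket x y \in Hplus_set}.
Proof.
move=> x y; elim/lspan_ind => {x} [|a x x' IHx IHx'|x gx] yH.
- by rewrite bracketC raddf0 oppr0 rpred0.
- by rewrite bracket_linearl rpredD ?rpredZ ?IHx ?IHx'.
elim/lspan_ind: yH => {y} [|a y y' IHy IHy'|y gy].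
- by rewrite raddf0 rpred0.
- by rewrite bracket_linearr rpredD ?rpredZ.
case: gx => [i|i di]; case: gy => [j|j dj].
- by rewrite bracketLL; apply/rpredZ/mem_lspan/Hplus_genL.
- by rewrite bracketLI; apply/rpredZ/mem_lspan/Hplus_genI/(leq_trans dj)/leq_addl.
- rewrite bracketIL -scaleNr; apply/rpredZ/mem_lspan/Hplus_genI.
  exact/(leq_trans di)/leq_addl.
- by rewrite bracketII rpred0.
Qed.

HB.instance Definition _ :=
  isBracketClosed.Build K (heisVir K) Hplus_set Hplus_bracket.

Definition Hplus : lieAlgType K := subalg Hplus_set.

Definition HplusL (i : nat) : Hplus :=
  @Subalg K (heisVir K) Hplus_set (hvL K i%:Z) (mem_lspan (Hplus_genL i)).

Definition HplusI (j : nat) (dj : (d <= j)%N) : Hplus :=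
  @Subalg K (heisVir K) Hplus_set (hvI K j%:Z) (mem_lspan (Hplus_genI dj)).

Lemma Hplus_ind (P : Hplus -> Prop) :
  P 0 -> (forall a x y, P x -> P y -> P (a *: x + y)) ->
  (forall i, P (HplusL i)) -> (forall j (dj : (d <= j)%N), P (HplusI dj)) ->
  forall x, P x.
Proof.
move=> P0 PD PL PI [x xH].
suff [xH' Px] : exists xH' : x \in Hplus_set, P (Subalg xH').
  by rewrite (bool_irrelevance xH xH').
elim/lspan_ind: (xH) => {x xH} [|a x y [xH Px] [yH Py]|x [i|j dj]].
- by exists (rpred0 _); rewrite (_ : Subalg _ = 0) //; exact: val_inj.
- exists (rpredD (rpredZ a xH) yH).
  have -> : Subalg (rpredD (rpredZ a xH) yH) = a *: Subalg xH + Subalg yH.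
    exact: val_inj.
  exact: PD.
- by exists (mem_lspan (Hplus_genL i)); exact: PL.
- by exists (mem_lspan (Hplus_genI dj)); exact: PI.
Qed.

Variable r : nat.

Inductive Hr_gen : Hplus -> Prop :=
| Hr_genL (i : nat) : (r < i)%N -> Hr_gen (HplusL i)
| Hr_genI (j : nat) (dj : (d <= j)%N) : (r + d < j)%N -> Hr_gen (HplusI dj).

Definition Hr_set : {pred Hplus} := lie_gen Hr_gen.

HB.instance Definition _ := LieSubalg.on Hr_set.

Fact Hr_ideal x : {in Hr_set, forall y, bracket x y \in Hr_set}.
Proof.
apply: lie_gen_ideal => {}x y; elim/Hplus_ind: x => [|a x x' IHx IHx'|i|j dj].
- by rewrite bracketC raddf0 oppr0 => _; exact: rpred0.
- move=> gy; rewrite bracket_linearl.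
  exact: (rpredD (rpredZ a (IHx gy)) (IHx' gy)).
- case=> [k rk|k dk rk].
  + have -> : bracket (HplusL i) (HplusL k)
              = (k%:Z - i%:Z)%:~R *: HplusL (i + k).
      by apply: val_inj; rewrite [LHS]bracketLL.
    by apply/rpredZ/mem_lie_gen/Hr_genL; rewrite (leq_trans rk) ?leq_addl.
  + have dik : (d <= i + k)%N by rewrite (leq_trans dk) ?leq_addl.
    have -> : bracket (HplusL i) (HplusI dk) = k%:~R *: HplusI dik.
      by apply: val_inj; rewrite [LHS]bracketLI.
    by apply/rpredZ/mem_lie_gen/Hr_genI; rewrite (leq_trans rk) ?leq_addl.
- case=> [k rk|k dk rk].
  + have dkj : (d <= k + j)%N by rewrite (leq_trans dj) ?leq_addl.
    have -> : bracket (HplusI dj) (HplusL k) = (- j%:~R) *: HplusI dkj.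
      by apply: val_inj; rewrite scaleNr; exact: bracketIL.
    by apply/rpredZ/mem_lie_gen/Hr_genI; lia.
  + have -> : bracket (HplusI dj) (HplusI dk) = 0.
      by apply: val_inj; exact: bracketII.
    exact: rpred0.
Qed.

HB.instance Definition _ := isBracketAbsorbing.Build K Hplus Hr_set Hr_ideal.

Definition Hbar : lieAlgType K := lie_quot Hr_set.

Definition HbarL (i : nat) : Hbar := lpi Hr_set (HplusL i).

(* HbarI i is the image of I_{i+d}. *)
Definition HbarI (i : nat) : Hbar := lpi Hr_set (HplusI (leq_addl i d)).

End HeisenbergVirasoroLie.

Section WeightModules.
Variable K : fieldType.

Definition hv_cartan : {pred heisVir K} :=
  lspan (fun x => x \in [:: hvL K 0; hvI K 0; hvC1 K; hvC2 K; hvC3 K]).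

Definition weight_module (M : lmodType K) (rho : lieModule (heisVir K) M) :=
  acts_diagonalizably rho hv_cartan.

End WeightModules.

Definition complexField (R : realType) : fieldType := R[i].

(* Main.v *)
(** Realize [L_i] as [X^(i+1) d/dX] and [I_j] as the function [X^j]. Then
    [A_m = \sum_i m^(i+1)/(i+1)! L_i] is the vector field [(e^(mX) - 1) d/dX] and
    [B_m = \sum_i m^(i+d)/(i+d)! I_(i+d)] is [e^(mX)] or [e^(mX) - 1] according to
    [d = 0] or [d = 1], up to truncation. Hence
    [[A_m, A_n] = (n-m) A_(m+n) - n A_n + m A_m], [[A_m, B_n] = n (B_(m+n) - B_n)]
    and [[B_m, B_n] = 0]. The error terms [m A_m - n A_n] and [- n B_n] are cancelled
    by the commutators of multiplication by [t - m alpha] with the shifts of [t].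
    The module is not a weight module because [L_0] acts as multiplication by [t],
    which has no eigenvector. *)

Require Import Defs.
From HB Require Import structures.
From mathcomp Require Import all_boot all_order all_algebra.
From mathcomp Require Import boolp reals complex monalg.
From mathcomp Require Import ring zify.

Set Implicit Arguments.
Unset Strict Implicit.
Unset Printing Implicit Defensive.

Import GRing.Theory.
Local Open Scope ring_scope.

(** * Truncated convolutions and exponential coefficients *)

(** Since [u] vanishes beyond [r], only the triangle [i + j <= r] of the square contributes, and it
    can be summed along the antidiagonals [k = i + j]. This is how truncation in the quotient
    algebra turns products into Cauchy products. *)
Lemma sum_antidiag (K : fieldType) (W : lmodType K) (r : nat) (u : nat -> W)
    (c : nat -> nat -> K) : (forall k, (r < k)%N -> u k = 0) ->
  \sum_(i < r.+1) \sum_(j < r.+1) c i j *: u (i + j)%N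
  = \sum_(k < r.+1) (\sum_(i < k.+1) c i (k - i)%N) *: u k.
Proof.
move=> u0.
transitivity (\sum_(i < r.+1) \sum_(k < r.+1 | (i <= k)%N) c i (k - i)%N *: u k).
  apply: eq_bigr => i _.
  transitivity (\sum_(0 <= j < r.+1 - i) c i j *: u (i + j)%N).
    rewrite -(big_mkord xpredT (fun j => c i j *: u (i + j)%N)).
    rewrite (big_cat_nat (leq0n _) (leq_subr i r.+1)) /= [X in _ + X]big1_seq ?addr0 //.
    by move=> j; rewrite mem_index_iota => /andP[_ jr]; rewrite u0 ?scaler0 //; lia.
  rewrite -(big_geq_mkord _ _ xpredT (fun k => c i (k - i)%N *: u k)).
  symmetry; apply: (etrans (big_addn 0 r.+1 i xpredT _)).
  by apply: eq_bigr => j _; rewrite addnK addnC.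
rewrite (exchange_big_dep xpredT) //=; apply: eq_bigr => k _; rewrite scaler_suml.
rewrite -(big_mkord xpredT (fun i => c i (k - i)%N *: u k)).
by rewrite (big_nat_widen _ _ _ _ _ (ltn_ord k)) big_mkord.
Qed.

Section Exponential.
Variable K : fieldType.
Hypothesis K0 : [pchar K] =i pred0.

(** Coefficient of [X^i] in [e^(xX)]. *)
Definition exp_coef (x : K) (i : nat) : K := x ^+ i / i`!%:R.

Let fact0 i : i`!%:R != 0 :> K.
Proof. by rewrite ((pcharf0P K).1 K0) -lt0n fact_gt0. Qed.

(** The differential equation [(e^(xX))' = x e^(xX)], read off coefficientwise. *)
Lemma exp_coefS x i : i.+1%:R * exp_coef x i.+1 = x * exp_coef x i.
Proof.
have i0 : i.+1%:R != 0 :> K by rewrite ((pcharf0P K).1 K0).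
rewrite /exp_coef factS natrM exprS; move: (i.+1%:R) i0 => a a0.
by field; rewrite fact0 a0.
Qed.

(** The binomial theorem divided by [k!], that is [e^(xX) e^(yX) = e^((x+y)X)]. *)
Lemma exp_coefD x y k :
  \sum_(i < k.+1) exp_coef x i * exp_coef y (k - i) = exp_coef (x + y) k.
Proof.
rewrite {3}/exp_coef addrC exprDn mulr_suml; apply: eq_bigr => -[i /= ik] _.
rewrite /exp_coef -(bin_fact (ik : (i <= k)%N)) -(mulr_natr (_ * _)).
have b0 : 'C(k, i)%:R != 0 :> K by rewrite ((pcharf0P K).1 K0) -lt0n bin_gt0.
rewrite !natrM; move: ('C(k, i)%:R : K) b0 => b b0.
by field; rewrite b0 !fact0.
Qed.

(* Coefficient of [X^(k+d)] in [(e^(xX) - 1) (e^(yX))' = y (e^((x+y)X) - e^(yX))]. *)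
Lemma exp_coef_deriv d x y k : (d <= 1)%N ->
  \sum_(i < k.+1) exp_coef x i.+1 * ((k - i + d)%:R * exp_coef y (k - i + d))
  = y * (exp_coef (x + y) (k + d) - exp_coef y (k + d)).
Proof.
move=> d1.
(* The full convolution [e^(xX) (e^(yX))']; its term [i = 0] is [(e^(yX))'], whose removal accounts
   for the [- 1]. *)
have tot : \sum_(i < (k + d).+2)
    exp_coef x i * (((k + d).+1 - i)%:R * exp_coef y ((k + d).+1 - i))
    = y * exp_coef (x + y) (k + d).
  rewrite big_ord_recr /= subnn mul0r mulr0 addr0 -exp_coefD mulr_sumr.
  apply: eq_bigr => -[i /= ik] _; rewrite subSn // exp_coefS; ring.
rewrite mulrBr -tot [in RHS]big_ord_recl /= subn0 exp_coefS.
have -> : exp_coef x 0 = 1 by rewrite /exp_coef expr0 divr1.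
rewrite mul1r [RHS]addrC addKr.
(* For [d = 0] the ranges agree. For [d = 1] one extra term [i = k.+2] remains, and its factor
   [(k + d).+1 - i] is zero. *)
case: d d1 tot => [|[]] // _ _.
  by rewrite addn0; apply: eq_bigr => i _; rewrite addn0.
rewrite !addn1 [RHS]big_ord_recr /= /bump /= add1n subnn mul0r mulr0 addr0.
by apply: eq_bigr => -[i /= ik] _; rewrite addn1 add1n subSS subSn.
Qed.

End Exponential.

(** * Brackets in the truncated algebra *)

Lemma bracket_sum (K : fieldType) (g : lieAlgType K) n (a b : 'I_n -> K) (u v : 'I_n -> g) :
  bracket (\sum_i a i *: u i) (\sum_j b j *: v j)
  = \sum_i \sum_j (a i * b j) *: bracket (u i) (v j).
Proof.
have E (x : g) : bracket x (\sum_j b j *: v j) = \sum_j b j *: bracket x (v j).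
  by rewrite linear_sum; apply: eq_bigr => j _; rewrite linearZ.
rewrite bracketC linear_sum -sumrN; apply: eq_bigr => i _.
rewrite linearZ /= -scalerN -bracketC E scaler_sumr.
by apply: eq_bigr => j _; rewrite scalerA.
Qed.

Section TruncatedAlgebra.
Variables (K : fieldType) (d r : nat).
Hypothesis K0 : [pchar K] =i pred0.

Lemma HbarL_eq0 k : (r < k)%N -> HbarL K d r k = 0.
Proof.
move=> rk; rewrite -(raddf0 (lpi (Hr_set r))); apply/lpi_eq.
by rewrite subr0; exact/mem_lie_gen/Hr_genL.
Qed.

Lemma HbarI_eq0 k : (r < k)%N -> HbarI K d r k = 0.
Proof.
move=> rk; rewrite -(raddf0 (lpi (Hr_set r))); apply/lpi_eq.
by rewrite subr0; apply/mem_lie_gen/Hr_genI; rewrite ltn_add2r.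
Qed.

Lemma bracket_HbarLL i j :
  bracket (HbarL K d r i) (HbarL K d r j) = (j%:R - i%:R) *: HbarL K d r (i + j).
Proof.
rewrite [LHS]lie_quot_bracketE -[RHS]linearZ /=; congr lpi; apply: val_inj.
by rewrite [LHS]bracketLL rmorphB.
Qed.

Lemma bracket_HbarLI i j :
  bracket (HbarL K d r i) (HbarI K d r j) = (j + d)%:R *: HbarI K d r (i + j).
Proof.
rewrite [LHS]lie_quot_bracketE -[RHS]linearZ /=; congr lpi; apply: val_inj.
by rewrite [LHS]bracketLI addnA.
Qed.

Lemma bracket_HbarII i j : bracket (HbarI K d r i) (HbarI K d r j) = 0.
Proof.
rewrite [LHS]lie_quot_bracketE -(raddf0 (lpi _)); congr lpi; apply: val_inj.
exact: bracketII.
Qed.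

(** At [x = m], [exp_L] and [exp_I] are the elements [A_m] and [B_m]. *)
Definition exp_L (x : K) : Hbar K d r :=
  \sum_(i < r.+1) exp_coef x i.+1 *: HbarL K d r i.

Definition exp_I (x : K) : Hbar K d r :=
  \sum_(i < r.+1) exp_coef x (i + d) *: HbarI K d r i.

Lemma bracket_exp_LI x y : (d <= 1)%N ->
  bracket (exp_L x) (exp_I y) = y *: (exp_I (x + y) - exp_I y).
Proof.
move=> d1; rewrite bracket_sum.
under eq_bigr do under eq_bigr do rewrite bracket_HbarLI scalerA.
rewrite (sum_antidiag (fun i j =>
  exp_coef x i.+1 * exp_coef y (j + d) * (j + d)%:R) HbarI_eq0) -sumrB scaler_sumr.
apply: eq_bigr => k _; rewrite -scalerBl scalerA -exp_coef_deriv //; congr (_ *: _).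
by apply: eq_bigr => i _; ring.
Qed.

Lemma bracket_exp_II x y : bracket (exp_I x) (exp_I y) = 0.
Proof.
rewrite bracket_sum big1 // => i _; rewrite big1 // => j _.
by rewrite bracket_HbarII scaler0.
Qed.

(** The commutator of vector fields [a d/dX] and [b d/dX] is [(a b' - b a') d/dX]. Each half is an
    instance of [exp_coef_deriv] with shift 1, whatever the [d] of the algebra, because [L_i] stands
    for [X^(i+1) d/dX]. *)
Lemma bracket_exp_LL x y :
  bracket (exp_L x) (exp_L y) =
  (y - x) *: exp_L (x + y) - y *: exp_L y + x *: exp_L x.
Proof.
rewrite bracket_sum.
under eq_bigr do under eq_bigr do rewrite bracket_HbarLL scalerA.
rewrite (sum_antidiag (fun i j =>
  exp_coef x i.+1 * exp_coef y j.+1 * (j%:R - i%:R)) HbarL_eq0).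
rewrite !scaler_sumr -sumrB -big_split; apply: eq_bigr => k _ /=.
rewrite !scalerA -scalerBl -scalerDl; congr (_ *: _).
have Hxy := exp_coef_deriv K0 x y k (leqnn 1).
have := exp_coef_deriv K0 y x k (leqnn 1); rewrite (addrC y x).
(* The reversal [i -> k - i] aligns the second convolution termwise with the first. *)
rewrite (reindex_inj rev_ord_inj) /= => Hyx.
transitivity (y * (exp_coef (x + y) (k + 1) - exp_coef y (k + 1))
   - x * (exp_coef (x + y) (k + 1) - exp_coef x (k + 1))); last by rewrite addn1; ring.
rewrite -Hxy -Hyx -sumrB; apply: eq_bigr => -[i /= ik] _.
have -> : (k.+1 - i.+1 = k - i)%N by lia.
have -> : (k - (k - i) = i)%N by lia.
by rewrite !addn1 -!natr1; ring.
Qed.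

End TruncatedAlgebra.

(** * Module structures from operators on a basis, and polynomial shifts *)

(** Both sides of the module identity are bilinear in the two Lie algebra elements, so it suffices
    to check it on basis pairs. *)
Lemma lieModule_of_basis (K : fieldType) (M : lmodType K)
    (op : hvIndex -> {linear M -> M}) :
  (forall a b v, linext (fun c => op c v) (hv_basis_bracket (hv_basis K) a b)
                 = op a (op b v) - op b (op a v)) ->
  exists rho : lieModule (heisVir K) M, forall a v, rho (hv_basis K a) v = op a v.
Proof.
move=> op_br; pose rho (x : heisVir K) v := linext (fun c => op c v) x.
have rhoU a v : rho (hv_basis K a) v = op a v by exact: linextU.
have rhol v : linear (rho^~ v) by exact: linext_is_linear.
have rhor x : linear (rho x).
  move=> a v w; rewrite /rho /linext scaler_sumr -big_split /=.
  by apply: eq_bigr => i _; rewrite linearP scalerDr !scalerA mulrC.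
have rho0l v : rho 0 v = 0 by exact: (raddf0 (linext (fun c => op c v))).
have rho0r x : rho x 0 = 0.
  by rewrite /rho /linext big1 // => i _; rewrite raddf0 scaler0.
have rho_br x y v : rho (bracket x y) v = rho x (rho y v) - rho y (rho x v).
  elim/malg_span_ind: x => [|a x x' IHx IHx'|i].
  - by rewrite bracketC raddf0 oppr0 !rho0l rho0r subr0.
  - rewrite bracket_linearl !rhol rhor IHx IHx' scalerBr.
    by rewrite opprD addrACA.
  elim/malg_span_ind: y => [|a y y' IHy IHy'|j].
  - by rewrite raddf0 !rho0l rho0r subr0.
  - rewrite bracket_linearr !rhol rhor IHy IHy' scalerBr.
    by rewrite opprD addrACA.
  by rewrite !rhoU -op_br /rho -bracket_hv_basis.
by exists (LieModule rhol rhor rho_br).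
Qed.

Section ActLinear.
Variables (K : fieldType) (g : lieAlgType K) (M : lmodType K).
Variable rho : lieModule g M.

HB.instance Definition _ x :=
  GRing.isLinear.Build K M M *:%R (act rho x) (act_linearr rho x).

End ActLinear.

Section Shift.
Variable K : fieldType.

Definition shift (m : int) : {poly K} -> {poly K} := comp_poly ('X - m%:~R%:P).

HB.instance Definition _ m := GRing.LRMorphism.on (shift m).

Lemma shiftZ m a f : shift m (a *: f) = a *: shift m f.
Proof. exact: linearZ. Qed.

Lemma shiftM m f g : shift m (f * g) = shift m f * shift m g.
Proof. exact: rmorphM. Qed.

Lemma shift_X m c : shift m ('X - c%:P) = 'X - (m%:~R + c)%:P.
Proof. by rewrite /shift comp_polyB comp_polyX comp_polyC polyCD opprD addrA. Qed.

Lemma shift_shift m n f : shift m (shift n f) = shift (m + n) f.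
Proof.
rewrite /shift -comp_polyA comp_polyB comp_polyX comp_polyC.
by rewrite rmorphD polyCD opprD addrA.
Qed.

End Shift.

(** * The module structure on the tensor product *)

Section TensorModule.
Variables (K : fieldType) (d r : nat) (V M : lmodType K).
Variables (rhoV : lieModule (Hbar K d r) V) (lambda alpha beta : K).
Hypotheses (K0 : [pchar K] =i pred0) (d1 : (d <= 1)%N) (lambda0 : lambda != 0).

(* Conversion on the quotient [tensor V {poly K}] is slow, so the module is
   built on any [M] having the universal property of this tensor product. *)
Variable t : V -> {poly K} -> M.
Hypotheses (t_linearl : forall f, linear (t^~ f)) (t_linearr : forall v, linear (t v)).
Hypothesis t_ind : forall P : M -> Prop, P 0 ->
  (forall a x y, P x -> P y -> P (a *: x + y)) -> (forall v f, P (t v f)) ->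
  forall x, P x.
Hypothesis t_lift : forall (N : lmodType K) (b : V -> {poly K} -> N),
  (forall f, linear (b^~ f)) -> (forall v, linear (b v)) ->
  exists g : {linear M -> N}, forall v f, g (t v f) = b v f.

Let tBl v w f : t (v - w) f = t v f - t w f.
Proof. exact: (GRing.zmod_morphism_linear (t_linearl f)). Qed.
Let tBr v f g : t v (f - g) = t v f - t v g.
Proof. exact: (GRing.zmod_morphism_linear (t_linearr v)). Qed.
Let t0l f : t 0 f = 0.
Proof. by rewrite -(subrr 0) tBl subrr. Qed.
Let tNl v f : t (- v) f = - t v f.
Proof. by rewrite -[- v]sub0r tBl t0l sub0r. Qed.
Let tDl v w f : t (v + w) f = t v f + t w f.
Proof. exact: (GRing.semilinear_linear (t_linearl f)).2. Qed.
Let tDr v f g : t v (f + g) = t v f + t v g.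
Proof. exact: (GRing.semilinear_linear (t_linearr v)).2. Qed.
Let actDl x y v : rhoV (x + y) v = rhoV x v + rhoV y v.
Proof. exact: (GRing.semilinear_linear (act_linearl rhoV v)).2. Qed.
Let actBl x y v : rhoV (x - y) v = rhoV x v - rhoV y v.
Proof. exact: (GRing.zmod_morphism_linear (act_linearl rhoV v)). Qed.
Let act0l v : rhoV 0 v = 0.
Proof. by rewrite -(subrr 0) actBl subrr. Qed.
Let actZl a x v : rhoV (a *: x) v = a *: rhoV x v.
Proof. exact: (GRing.scalable_linear (act_linearl rhoV v)). Qed.
Let tZl a v f : t (a *: v) f = a *: t v f.
Proof. exact: (GRing.scalable_linear (t_linearl f)). Qed.
Let tZr a v f : t v (a *: f) = a *: t v f.
Proof. exact: (GRing.scalable_linear (t_linearr v)). Qed.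

Local Notation A m := (exp_L d r (m%:~R : K)).
Local Notation B m := (exp_I d r (m%:~R : K)).
Local Notation xi m := ('X - (m%:~R * alpha)%:P : {poly K}).

Definition twisted_L (m : int) (v : V) (f : {poly K}) : M :=
  t v (lambda ^ m *: (xi m * shift m f))
  + t (rhoV (A m) v) (lambda ^ m *: shift m f).

Definition twisted_I (m : int) (v : V) (f : {poly K}) : M :=
  t (rhoV (B m) v) (lambda ^ m *: (beta *: shift m f)).

Lemma exists_twisted_ops : exists op : hvIndex -> {linear M -> M},
  [/\ forall m v f, op (idxL m) (t v f) = twisted_L m v f,
      forall m v f, op (idxI m) (t v f) = twisted_I m v f &
      [/\ forall x, op idxC1 x = 0, forall x, op idxC2 x = 0
        & forall x, op idxC3 x = 0]].
Proof.
have scale_linear c a (p q : {poly K}) : c *: (a *: p + q) = a *: (c *: p) + c *: q.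
  by rewrite scalerDr !scalerA mulrC.
have /choice [opL opLE] : forall m, exists g : {linear M -> M},
    forall v f, g (t v f) = twisted_L m v f.
  move=> m; apply: t_lift => [f|v] a x y; rewrite /twisted_L.
    rewrite act_linearr !t_linearl scalerDr; exact: addrACA.
  rewrite (linearP (shift m)) mulrDr -scalerAr !scale_linear !t_linearr.
  rewrite scalerDr; exact: addrACA.
have /choice [opI opIE] : forall m, exists g : {linear M -> M},
    forall v f, g (t v f) = twisted_I m v f.
  move=> m; apply: t_lift => [f|v] a x y; rewrite /twisted_I.
    by rewrite act_linearr !t_linearl.
  by rewrite (linearP (shift m)) !scale_linear t_linearr.
exists (fun c => match c with idxL m => opL m | idxI m => opI m
                 | _ => \0 : {linear M -> M} end).
by split.
Qed.

(** A normal form in which every term carries the common factor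
    [lambda ^ (m + n) *: shift (m + n) f]. Moving the shift by [m] past [xi n] replaces it by
    [xi n - m], the source of all correction terms. *)
Lemma comp_op_LL (op : hvIndex -> {linear M -> M}) m n v f :
  (forall m v f, op (idxL m) (t v f) = twisted_L m v f) ->
  op (idxL m) (op (idxL n) (t v f)) =
    t v (lambda ^ (m + n) *: (xi m * (xi n - m%:~R%:P) * shift (m + n) f))
  + t (rhoV (A m) v) (lambda ^ (m + n) *: ((xi n - m%:~R%:P) * shift (m + n) f))
  + t (rhoV (A n) v) (lambda ^ (m + n) *: (xi m * shift (m + n) f))
  + t (rhoV (A m) (rhoV (A n) v)) (lambda ^ (m + n) *: shift (m + n) f).
Proof.
move=> opE; rewrite opE /twisted_L raddfD /= !opE /twisted_L.
rewrite !shiftZ !shiftM shift_X !shift_shift -!scalerAr !scalerA -!expfzDr //.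
rewrite (_ : 'X - (m%:~R + _)%:P = xi n - m%:~R%:P); last first.
  by rewrite polyCD opprD addrA addrAC.
rewrite -!mulrA -!addrA; congr (_ + _); exact: addrCA.
Qed.

Lemma comp_op_LI (op : hvIndex -> {linear M -> M}) m n v f :
  (forall m v f, op (idxL m) (t v f) = twisted_L m v f) ->
  (forall m v f, op (idxI m) (t v f) = twisted_I m v f) ->
  op (idxL m) (op (idxI n) (t v f)) =
    t (rhoV (B n) v) (lambda ^ (m + n) *: (beta *: (xi m * shift (m + n) f)))
  + t (rhoV (A m) (rhoV (B n) v)) (lambda ^ (m + n) *: (beta *: shift (m + n) f)).
Proof.
move=> opE opE'; rewrite opE' opE /twisted_L.
by rewrite !shiftZ !shift_shift -!scalerAr !(scalerA (lambda ^ m)) -!expfzDr.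
Qed.

Lemma comp_op_IL (op : hvIndex -> {linear M -> M}) m n v f :
  (forall m v f, op (idxL m) (t v f) = twisted_L m v f) ->
  (forall m v f, op (idxI m) (t v f) = twisted_I m v f) ->
  op (idxI n) (op (idxL m) (t v f)) =
    t (rhoV (B n) v) (lambda ^ (m + n) *: (beta *: ((xi m - n%:~R%:P) * shift (m + n) f)))
  + t (rhoV (B n) (rhoV (A m) v)) (lambda ^ (m + n) *: (beta *: shift (m + n) f)).
Proof.
move=> opE opE'; rewrite opE raddfD /= !opE' /twisted_I.
rewrite !shiftZ shiftM shift_X !shift_shift (addrC n m).
rewrite (_ : 'X - (n%:~R + _)%:P = xi m - n%:~R%:P); last first.
  by rewrite polyCD opprD addrA addrAC.
rewrite !scalerA -!mulrA (mulrC beta) !mulrA -expfzDr // (addrC n m) //.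
Qed.

Lemma comp_op_II (op : hvIndex -> {linear M -> M}) m n v f :
  (forall m v f, op (idxI m) (t v f) = twisted_I m v f) ->
  op (idxI m) (op (idxI n) (t v f)) =
  t (rhoV (B m) (rhoV (B n) v)) (lambda ^ (m + n) *: (beta ^+ 2 *: shift (m + n) f)).
Proof.
move=> opE'; rewrite !opE' /twisted_I.
rewrite !shiftZ !shift_shift !scalerA; congr (t _ (_ *: _)).
by rewrite expfzDr //; ring.
Qed.

Lemma t_ext (N : lmodType K) (F G : {linear M -> N}) :
  (forall v f, F (t v f) = G (t v f)) -> F =1 G.
Proof.
move=> FG x; elim/t_ind: x => [|a x y IHx IHy|//]; first by rewrite !raddf0.
by rewrite !linearP IHx IHy.
Qed.

Let mul_sub_const (p P : {poly K}) c : (p - c%:P) * P = p * P - c *: P.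
Proof. by rewrite mulrBl mul_polyC. Qed.

(** The mixed terms of the commutator leave [n A_n - m A_m], which is exactly what [[A_m, A_n]]
    lacks to equal [(n-m) A_(m+n)]. *)
Lemma op_bracket_LL (op : hvIndex -> {linear M -> M}) m n x :
  (forall m v f, op (idxL m) (t v f) = twisted_L m v f) ->
  (n - m)%:~R *: op (idxL (m + n)) x =
  op (idxL m) (op (idxL n) x) - op (idxL n) (op (idxL m) x).
Proof.
move=> opE.
apply: (t_ext (F := (n - m)%:~R \*: op (idxL (m + n)))
  (G := (op (idxL m) \o op (idxL n)) \- (op (idxL n) \o op (idxL m)))) => {}x f.
rewrite /= opE !comp_op_LL // (addrC n m) /twisted_L !scalerAr.
have := congr1 (fun z => rhoV z x) (bracket_exp_LL d r K0 (m%:~R) (n%:~R)).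
rewrite /= act_bracket -rmorphB -rmorphD /= => /eqP; rewrite subr_eq => /eqP ->.
rewrite actDl actBl !actZl.
move: (lambda ^ (m + n) *: _) => P.
(* This amounts to [n xi_n - m xi_m = (n-m) xi_(m+n)], where the terms in [alpha] match because
   [n^2 - m^2 = (n-m)(n+m)]. *)
have E : xi m * (xi n - m%:~R%:P) * P =
  xi n * (xi m - n%:~R%:P) * P + (n%:~R - m%:~R) *: (xi (m + n) * P).
  rewrite -mul_polyC !rmorphD !rmorphM !rmorphN /=; ring.
rewrite !(tBl, tDl) !tZl E [in X in _ = X - _]tDr tZr.
rewrite (mul_sub_const (xi m)) (mul_sub_const (xi n)) !tBr !tZr.
rewrite tNl tZl -rmorphB scalerDr.
(* The group [2*6] is the left-hand side, [4*8] is the cancelling pair in [m A_m], and the middle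
   group, with [5*7] restoring [xi m - n] on [A_n], is the subtracted composite. *)
rewrite [X in _ = X - _](AC (2*2*1*4) ((2*6)*(1*(5*7)*3*9)*(4*8))) /= addNr addr0.
by rewrite addrK.
Qed.

(** Shifting [xi m] by [n] contributes [n B_n], which cancels the [- n B_n] of [[A_m, B_n]]. *)
Lemma op_bracket_LI (op : hvIndex -> {linear M -> M}) m n x :
  (forall m v f, op (idxL m) (t v f) = twisted_L m v f) ->
  (forall m v f, op (idxI m) (t v f) = twisted_I m v f) ->
  n%:~R *: op (idxI (m + n)) x =
  op (idxL m) (op (idxI n) x) - op (idxI n) (op (idxL m) x).
Proof.
move=> opE opE'.
apply: (t_ext (F := n%:~R \*: op (idxI (m + n)))
  (G := (op (idxL m) \o op (idxI n)) \- (op (idxI n) \o op (idxL m)))) => {}x f.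
rewrite /= opE' comp_op_LI // comp_op_IL // /twisted_I !scalerAr.
have := congr1 (fun z => rhoV z x) (bracket_exp_LI r K0 (m%:~R) (n%:~R) d1).
rewrite /= act_bracket -rmorphD /= => /eqP; rewrite subr_eq => /eqP ->.
rewrite actZl actBl.
move: (_ *: (_ *: _)) => P.
rewrite (mul_sub_const (xi m)) tBr tZr !(tBl, tDl) !tZl tBl scalerBr.
by rewrite [X in _ = X - _](AC (1*3) (2*(1*3*4))) addrK.
Qed.

Lemma op_bracket_II (op : hvIndex -> {linear M -> M}) m n x :
  (forall m v f, op (idxI m) (t v f) = twisted_I m v f) ->
  op (idxI m) (op (idxI n) x) - op (idxI n) (op (idxI m) x) = 0.
Proof.
move=> opE.
apply: (t_ext (F := (op (idxI m) \o op (idxI n)) \- (op (idxI n) \o op (idxI m)))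
  (G := \0)) => {}x f.
rewrite /= !comp_op_II // (addrC n m) -tBl -act_bracket bracket_exp_II.
by rewrite act0l t0l.
Qed.

(** As the central elements act by zero, the cocycle terms of the brackets disappear and only the
    commutators of the [L_m] and [I_n] need checking. *)
Lemma exists_lieModule : exists rho : lieModule (heisVir K) M,
  [/\ forall m v f, rho (hvL K m) (t v f) = twisted_L m v f,
      forall m v f, rho (hvI K m) (t v f) = twisted_I m v f
    & forall x, [/\ rho (hvC1 K) x = 0, rho (hvC2 K) x = 0 & rho (hvC3 K) x = 0]].
Proof.
have [op [opL opI [op1 op2 op3]]] := exists_twisted_ops.
suff /lieModule_of_basis [rho rhoE] : forall a b v,
    linext (fun c => op c v) (hv_basis_bracket (hv_basis K) a b)
    = op a (op b v) - op b (op a v).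
  by exists rho; split=> [m v f|m v f|x]; rewrite ?rhoE ?opL ?opI //; split; rewrite rhoE.
move=> a b v; pose F c := op c v.
have FE a' c x y : linext F (a' *: hv_basis K x + c *: hv_basis K y) = a' *: F x + c *: F y.
  by rewrite linearP linearZ /= !linextU.
have FZ c x : linext F (c *: hv_basis K x) = c *: F x by rewrite linearZ /= linextU.
rewrite -/F; case: a b => [m|m|||] [n|n|||] /=;
  rewrite ?op1 ?op2 ?op3 ?(raddf0, subr0, sub0r, oppr0) //.
- by rewrite FE /F op1 scaler0 addr0 op_bracket_LL.
- by rewrite FE /F op2 scaler0 addr0 op_bracket_LI.
- rewrite raddfN /= FE /F op2 scaler0 addr0 op_bracket_LI //.
  by rewrite opprB.
- by rewrite FZ /F op3 scaler0 op_bracket_II.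
Qed.

(* If [X x = c x] then the constant coefficient [x_0] vanishes: [c x_0 = 0],
   and for [c = 0] it is the coefficient of degree 1 of [X x]. A basis of
   eigenvectors would therefore span a space without constant terms. *)
Lemma mulX_not_weight (rho : lieModule (heisVir K) M) :
  (forall v f, rho (hvL K 0) (t v f) = t v ('X * f)) ->
  (exists v : V, v != 0) -> ~ weight_module rho.
Proof.
move=> rho0 [v v0] [S [[_ Sspan] Seig]].
(* [cf k] extracts the coefficient of degree [k] in the polynomial variable, with values in [V]. *)
have /choice [cf cfE] : forall k, exists g : {linear M -> V},
    forall v f, g (t v f) = f`_k *: v.
  move=> k; apply: t_lift => [f|w] a x y /=.
    by rewrite scalerDr !scalerA mulrC.
  by rewrite coefD coefZ scalerDl scalerA.
have cf0 x : cf 0%N (rho (hvL K 0) x) = 0.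
  apply: (t_ext (F := cf 0%N \o act rho (hvL K 0)) (G := \0)) => w f /=.
  by rewrite rho0 cfE coefXM scale0r.
have cfS k x : cf k.+1 (rho (hvL K 0) x) = cf k x.
  apply: (t_ext (F := cf k.+1 \o act rho (hvL K 0)) (G := cf k)) => w f /=.
  by rewrite rho0 !cfE coefXM.
have eig c x : rho (hvL K 0) x = c *: x -> cf 0%N x = 0.
  move=> xc; have [c0|c0] := eqVneq c 0.
    by rewrite -cfS xc c0 scale0r raddf0.
  apply/eqP; have := cf0 x; rewrite xc linearZ /= => /eqP.
  by rewrite scaler_eq0 (negPf c0).
(* Contradiction at [t v 1], whose constant coefficient is the nonzero [v]. *)
suff cfM x : cf 0%N x = 0.
  by have := cfE 0%N v 1; rewrite cfM coef1 scale1r => ve; rewrite -ve eqxx in v0.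
elim/lspan_ind: (Sspan x) => {x} [|a x y x0 y0|x Sx]; first exact: raddf0.
  by rewrite linearP x0 y0 scaler0 addr0.
have [|c] := Seig x Sx (hvL K 0); last exact: eig.
by apply: mem_lspan; rewrite inE eqxx.
Qed.

Let t_act_sum n (x : 'I_n -> Hbar K d r) v f :
  t (rhoV (\sum_i x i) v) f = \sum_i t (rhoV (x i) v) f.
Proof.
by apply: (big_morph (fun y => t (rhoV y v) f)) => [y z|]; rewrite ?actDl ?tDl ?act0l.
Qed.

Lemma exists_nonweight_lieModule : (exists v : V, v != 0) ->
  exists rho : lieModule (heisVir K) M,
  [/\ forall (m : int) (v : V) (f : {poly K}),
        rho (hvL _ m) (t v f) =
          t v (lambda ^ m *: (('X - (m%:~R * alpha)%:P) * (f \Po ('X - (m%:~R)%:P))))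
          + \sum_(i < r.+1)
              t (rhoV ((m%:~R ^+ i.+1 / (i.+1)`!%:R) *: HbarL _ d r i) v)
                (lambda ^ m *: (f \Po ('X - (m%:~R)%:P))),
      forall (m : int) (v : V) (f : {poly K}),
        rho (hvI _ m) (t v f) =
          \sum_(i < r.+1)
            t (rhoV ((m%:~R ^+ (i + d) / (i + d)`!%:R) *: HbarI _ d r i) v)
              (lambda ^ m *: (beta *: (f \Po ('X - (m%:~R)%:P)))),
      forall (v : V) (f : {poly K}),
        [/\ rho (hvC1 _) (t v f) = 0, rho (hvC2 _) (t v f) = 0
          & rho (hvC3 _) (t v f) = 0]
    & ~ weight_module rho].
Proof.
move=> V0; have [rho [rhoL rhoI rhoC]] := exists_lieModule.
exists rho; split=> [m v f|m v f|v f|]; [| |exact: rhoC|].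
- by rewrite rhoL -t_act_sum.
- by rewrite rhoI -t_act_sum.
apply: mulX_not_weight => // v f; rewrite rhoL /twisted_L t_act_sum.
(* At [m = 0] each coefficient contains [0^(i+1) = 0], so [L_0] reduces to multiplication by
   ['X]. *)
rewrite [X in _ + X]big1 => [|i _]; last first.
  by rewrite /exp_coef expr0n mul0r scale0r act0l t0l.
by rewrite addr0 expr0z scale1r mul0r subr0 /shift subr0 comp_polyXr.
Qed.

End TensorModule.

Theorem proposition2p2 (R : realType) (d r : nat) (hd : d = 0%N \/ d = 1%N)
    (V : lmodType (complexField R)) (rhoV : lieModule (Hbar (complexField R) d r) V)
    (hV : exists v : V, v != 0)
    (lambda alpha beta : complexField R) (hlambda : lambda != 0) :
  exists rho : lieModule (heisVir (complexField R)) (tensor V {poly complexField R}),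
    [/\ forall (m : int) (v : V) (f : {poly complexField R}),
          rho (hvL _ m) (tens v f) =
            tens v (lambda ^ m *: (('X - (m%:~R * alpha)%:P)
                                     * (f \Po ('X - (m%:~R)%:P))))
            + \sum_(i < r.+1)
                tens (rhoV ((m%:~R ^+ i.+1 / (i.+1)`!%:R) *: HbarL _ d r i) v)
                     (lambda ^ m *: (f \Po ('X - (m%:~R)%:P))),
        forall (m : int) (v : V) (f : {poly complexField R}),
          rho (hvI _ m) (tens v f) =
            \sum_(i < r.+1)
              tens (rhoV ((m%:~R ^+ (i + d) / (i + d)`!%:R) *: HbarI _ d r i) v)
                   (lambda ^ m *: (beta *: (f \Po ('X - (m%:~R)%:P)))),
        forall (v : V) (f : {poly complexField R}),
          [/\ rho (hvC1 _) (tens v f) = 0,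
              rho (hvC2 _) (tens v f) = 0 &
              rho (hvC3 _) (tens v f) = 0]
      & ~ weight_module rho].
Proof.
have d1 : (d <= 1)%N by case: hd => ->.
have K0 : [pchar complexField R] =i pred0 by exact: (@Num.Theory.pchar_num R[i]).
(* The remaining goals are bilinearity, generation by pure tensors and the universal property of
   [tensor]. *)
apply: (exists_nonweight_lieModule rhoV alpha beta K0 d1 hlambda) => //.
- exact: tens_linearl.
- exact: tens_linearr.
- exact: tensor_ind.
- by move=> N b; exact: tensor_lift.
Qed.
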